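(* Let $f\in\mathcal{F}$, let the parameters be randomly initialized as described, and run SGD as described, under the no-explosion assumption with constant $K$. Then there is a constant $C>0$ depending only on $d$ and $K$ (not on $m,\eta,t,T,N,\|f\|_{\mathcal{F}},{\bm x}$) such that for every realization, every ${\bm x}\in\Gamma$, every $t\in\{1,\dots,T\}$ and every $i\in\{1,\dots,m\}$, writing $\rho:=m^{-\alpha-2\beta}\|f\|_{\mathcal{F}}+1$: (a) $\|{\bm w}_i^{(t)}-{\bm w}_i^{(0)}\|_2\le C\,\eta t m^{-\alpha}\rho$; (b) $\big|\psi({\bm x};W^{(0)}+W_t)-g({\bm x};W^{(0)}+W_t)\big|\le C\big(\eta^3t^3m^{1-4\alpha}\rho^3+\eta t m^{1-2\alpha-2\beta}\rho\big)$; (c) $\big\|\nabla_W\mathcal{L}(\psi({\bm x};W^{(0)}+W_t))-\nabla_W\mathcal{L}(g({\bm x};W^{(0)}+W_t))\big\|_{2,1}\le C\big(\eta^5t^5m^{2-7\alpha}\rho^5+\eta^3t^3m^{2-5\alpha-2\beta}\rho^3+\eta^2t^2m^{2-4\alpha-3\beta}\rho^2+\eta^2t^2m^{1-4\alpha-2\beta}\|f\|_{\mathcal{F}}\rho^2+\eta t m^{2-3\alpha-4\beta}\rho+m^{2-2\alpha-5\beta}+m^{1-2\alpha-4\beta}\|f\|_{\mathcal{F}}\big)$.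
   Context: Fix an integer $d\ge1$ and let $\Gamma=\{{\bm x}\in\mathbb{R}^d:\|{\bm x}\|_2\le1\}$. Fix exponents $\alpha,\beta\ge0$ and a width $m\in\mathbb{N}^+$. Random initialization: for $i=1,\dots,m$, independently, $a_i^{(0)}\sim\mathcal{U}(-m^{-\alpha},m^{-\alpha})$, ${\bm w}_i^{(0)}\in\mathbb{R}^d$ has i.i.d. coordinates $\sim\mathcal{U}(-m^{-\beta},m^{-\beta})$, and $b_i^{(0)}\sim\mathcal{U}(-m^{-\beta},m^{-\beta})$. Let $\Lambda:=[-m^{-\alpha},m^{-\alpha}]\times[-m^{-\beta},m^{-\beta}]^d\times[-m^{-\beta},m^{-\beta}]$, $p(\theta)=|\Lambda|^{-1}\mathbb{I}_{\theta\in\Lambda}$. For $\theta=(a,{\bm w},b)\in\Lambda$, ${\bm x}\in\Gamma$: ${\bm\zeta}({\bm x};\theta)=a\big(2d({\bm w}^\top{\bm x}+b)^2+12({\bm w}^\top{\bm x})({\bm w}^\top{\bm x}+b)+6({\bm w}^\top{\bm w})(\|{\bm x}\|_2^2-1)\big){\bm x}\,\mathbb{I}_{{\bm w}^\top{\bm x}+b\ge0}$. $\mathcal{F}$ is the class of $f:\Gamma\to\mathbb{R}$ with $f({\bm x})=\int_\Lambda{\bm\alpha}(\theta)^\top{\bm\zeta}({\bm x};\theta)\,{\rm d}\theta$ for some ${\bm\alpha}:\Lambda\to\mathbb{R}^d$, normed by $\|f\|_{\mathcal{F}}:=\inf_{{\bm\alpha}}\max_{\theta\in\Lambda}\|{\bm\alpha}(\theta)\|_2/p(\theta)$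 (infimum assumed attained). PINN: for $W=[{\bm w}_1~\dots~{\bm w}_m]$, ${\bm w}_i\in\mathbb{R}^d$ (only the ${\bm w}_i$ are trainable; $a_i^{(0)},b_i^{(0)}$ stay fixed), $$\psi({\bm x};W)=\sum_{i=1}^m a_i^{(0)}\Big(2d({\bm w}_i^\top{\bm x}+b_i^{(0)})^3+12({\bm w}_i^\top{\bm x}+b_i^{(0)})^2({\bm w}_i^\top{\bm x})+6({\bm w}_i^\top{\bm x}+b_i^{(0)})({\bm w}_i^\top{\bm w}_i)(\|{\bm x}\|_2^2-1)\Big)\mathbb{I}_{{\bm w}_i^\top{\bm x}+b_i^{(0)}\ge0}$$ (this is $\Delta[(\|{\bm x}\|_2^2-1)\sum_i a_i^{(0)}\sigma({\bm w}_i^\top{\bm x}+b_i^{(0)})]$ with $\sigma(s)=\max(0,s)^3$). Pseudo network: $$g({\bm x};W)=\sum_{i=1}^m a_i^{(0)}({\bm w}_i^\top{\bm x}+b_i^{(0)})\Big(2d({{\bm w}_i^{(0)}}^\top{\bm x}+b_i^{(0)})^2+12({{\bm w}_i^{(0)}}^\top{\bm x})({{\bm w}_i^{(0)}}^\top{\bm x}+b_i^{(0)})+6({{\bm w}_i^{(0)}}^\top{\bm w}_i^{(0)})(\|{\bm x}\|_2^2-1)\Big)\mathbb{I}_{{{\bm w}_i^{(0)}}^\top{\bm x}+b_i^{(0)}\ge0}.$$ Loss: $\mathcal{L}(h({\bm x})):=|h({\bm x})-f({\bm x})|^2$. SGD: training set $X=\{{\bm x}_1,\dots,{\bm x}_N\}\subset\Gamma$;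 $W^{(0)}=[{\bm w}_1^{(0)}~\dots~{\bm w}_m^{(0)}]$; for $t=1,\dots,T$, pick ${\bm x}^{(t)}$ uniformly from $X$ and set $W^{(t)}=W^{(t-1)}-\eta\nabla_W\mathcal{L}(\psi({\bm x}^{(t)};W^{(t-1)}))$, with learning rate $\eta>0$; $W_t:=W^{(t)}-W^{(0)}$, and ${\bm w}_i^{(t)}$ is the $i$-th column of $W^{(t)}$. Norm: $\|W\|_{2,1}=\sum_i\|{\bm w}_i\|_2$. No-explosion assumption: there is a constant $K\ge1$, independent of $m,\eta,t,T,N$, such that $\|{\bm w}_i^{(t)}\|_2\le K$ and $|\psi({\bm x};W^{(t)})|\le K$ for all $i$, all $t\in\{0,\dots,T\}$ and all ${\bm x}\in\Gamma$. *)

(* Defs.v *)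
From HB Require Import structures.
From mathcomp Require Import all_boot all_order all_algebra.
From mathcomp Require Import all_classical all_reals all_analysis.
Set Implicit Arguments. Unset Strict Implicit. Unset Printing Implicit Defensive.
Import Order.TTheory GRing.Theory Num.Theory.
Local Open Scope classical_set_scope.
Local Open Scope ring_scope.

Section PINN.
Variables (R : realType) (d : nat).

Definition vec := 'rV[R]_d.

Definition dotv (u v : vec) : R := \sum_(j < d) u 0 j * v 0 j.
Definition norm2 (u : vec) : R := Num.sqrt (dotv u u).

Definition inGamma (x : vec) : Prop := norm2 x <= 1.

Definition mpow (m : nat) (e : R) : R := (m%:R : R) `^ e.

Definition zeta (a : R) (w : vec) (b : R) (x : vec) : vec :=
  let s := dotv w x + b in
  (if 0 <= s then
     a * (2 * d%:R * s ^+ 2 + 12 * dotv w x * s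
          + 6 * dotv w w * (dotv x x - 1))
   else 0) *: x.

Definition th_a (th : seq R) : R := nth 0 th 0.
Definition th_w (th : seq R) : vec := \row_(j < d) nth 0 th j.+1.
Definition th_b (th : seq R) : R := nth 0 th d.+1.
Definition zeta_th (th : seq R) (x : vec) : vec :=
  zeta (th_a th) (th_w th) (th_b th) x.

Definition radii (m : nat) (al be : R) : seq R :=
  mpow m (- al) :: nseq d.+1 (mpow m (- be)).

Definition inLambda (m : nat) (al be : R) (th : seq R) : Prop :=
  size th = d.+2 /\ all2 (fun t r => `|t| <= r) th (radii m al be).

Definition volLambda (m : nat) (al be : R) : R :=
  \prod_(r <- radii m al be) (2 * r).
Definition pdens (m : nat) (al be : R) : R := (volLambda m al be)^-1.

(* Lebesgue integral over the box prod_k [-r_k, r_k], written as an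
   iterated integral (first variable outermost). *)
Fixpoint box_int (rs : seq R) (F : seq R -> R) : R :=
  match rs with
  | [::] => F [::]
  | r :: rs' => Rintegral (@lebesgue_measure R) `[- r, r]
                  (fun s => box_int rs' (fun v => F (s :: v)))
  end.

Definition F_rep (m : nat) (al be : R) (f : vec -> R) (alpha : seq R -> vec)
  : Prop :=
  (forall j : 'I_d,
     measurable_fun [set: (d.+2).-tuple R] (fun t => alpha (val t) 0 j)) /\
  forall x, inGamma x ->
    f x = box_int (radii m al be) (fun th => dotv (alpha th) (zeta_th th x)).

Definition rep_bound (m : nat) (al be : R) (alpha : seq R -> vec) (c : R)
  : Prop :=
  forall th, inLambda m al be th -> norm2 (alpha th) / pdens m al be <= c.

(* ||f||_F = nf  (the infimum over representations is attained) *)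
Definition Fnorm_is (m : nat) (al be : R) (f : vec -> R) (nf : R) : Prop :=
  (exists alpha, F_rep m al be f alpha /\ rep_bound m al be alpha nf) /\
  (forall alpha c, F_rep m al be f alpha -> rep_bound m al be alpha c ->
     nf <= c).

Definition psi (m : nat) (a0 b0 : 'I_m -> R) (W : 'I_m -> vec) (x : vec) : R :=
  \sum_(i < m)
    let s := dotv (W i) x + b0 i in
    if 0 <= s then
      a0 i * (2 * d%:R * s ^+ 3 + 12 * s ^+ 2 * dotv (W i) x
              + 6 * s * dotv (W i) (W i) * (dotv x x - 1))
    else 0.

Definition gpseudo (m : nat) (a0 b0 : 'I_m -> R) (W0 W : 'I_m -> vec)
  (x : vec) : R :=
  \sum_(i < m)
    let s0 := dotv (W0 i) x + b0 i in
    if 0 <= s0 then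
      a0 i * (dotv (W i) x + b0 i) *
        (2 * d%:R * s0 ^+ 2 + 12 * dotv (W0 i) x * s0
         + 6 * dotv (W0 i) (W0 i) * (dotv x x - 1))
    else 0.

(* Gradients w.r.t. w_i (the indicator is treated as locally constant,
   i.e. the formal / autodiff gradient). *)
Definition grad_psi_i (m : nat) (a0 b0 : 'I_m -> R) (W : 'I_m -> vec)
  (x : vec) (i : 'I_m) : vec :=
  let u := dotv (W i) x in
  let s := u + b0 i in
  let q := dotv x x - 1 in
  if 0 <= s then
    a0 i *: ((6 * d%:R * s ^+ 2 + 24 * s * u + 12 * s ^+ 2
              + 6 * q * dotv (W i) (W i)) *: x + (12 * s * q) *: W i)
  else 0.

Definition grad_g_i (m : nat) (a0 b0 : 'I_m -> R) (W0 : 'I_m -> vec)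
  (x : vec) (i : 'I_m) : vec :=
  let u0 := dotv (W0 i) x in
  let s0 := u0 + b0 i in
  if 0 <= s0 then
    (a0 i * (2 * d%:R * s0 ^+ 2 + 12 * u0 * s0
             + 6 * dotv (W0 i) (W0 i) * (dotv x x - 1))) *: x
  else 0.

(* gradient of L(h(x)) = |h(x) - f(x)|^2 w.r.t. w_i *)
Definition gradL_psi_i (m : nat) (a0 b0 : 'I_m -> R) (f : vec -> R)
  (W : 'I_m -> vec) (x : vec) (i : 'I_m) : vec :=
  (2 * (psi a0 b0 W x - f x)) *: grad_psi_i a0 b0 W x i.
Definition gradL_g_i (m : nat) (a0 b0 : 'I_m -> R) (f : vec -> R)
  (W0 W : 'I_m -> vec) (x : vec) (i : 'I_m) : vec :=
  (2 * (gpseudo a0 b0 W0 W x - f x)) *: grad_g_i a0 b0 W0 x i.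

Definition norm21 (m : nat) (G : 'I_m -> vec) : R := \sum_(i < m) norm2 (G i).

Fixpoint sgd (m : nat) (a0 b0 : 'I_m -> R) (f : vec -> R) (eta : R)
  (W0 : 'I_m -> vec) (xs : nat -> vec) (t : nat) : 'I_m -> vec :=
  match t with
  | 0 => W0
  | t'.+1 => let Wp := sgd a0 b0 f eta W0 xs t' in
             fun i => Wp i - eta *: gradL_psi_i a0 b0 f Wp (xs t'.+1) i
  end.

End PINN.

(* Main.v *)
Require Import Defs.
From HB Require Import structures.
From mathcomp Require Import all_boot all_order all_algebra.
From mathcomp Require Import all_classical all_reals all_analysis.
From mathcomp Require Import ring lra.
Import Order.TTheory GRing.Theory Num.Theory.
Local Open Scope ring_scope.
Set Implicit Arguments. Unset Strict Implicit.

(* With A = m^-alpha, B = m^-beta and eps = eta t A rho: one SGD step moves a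
   neuron by at most O(eta A rho), since |f| = O(A B^2 ||f||_F) by the integral
   representation and the no-explosion bound controls psi and its gradient;
   this is (a).  So each w_i stays within delta = O(eps) of its initial value,
   whose size is O(B).  Writing psi and g as sums of a_i s_i P(w_i) and
   a_i s_i P(w_i^0), with P quadratic, each neuron contributes
   O(A (B^2 delta + delta^3)) to psi - g; where the two indicators differ this
   holds because |s_i| <= delta.  Summing over i gives (b).  Finally (c) follows
   from (psi - f) grad psi - (g - f) grad g
     = (psi - g) grad psi + (g - f) (grad psi - grad g)
   by bounding the last difference by the sum of the norms. *)

(** * The Euclidean inner product and norm on ['rV[R]_d] *)

Section Norm.
Context {R : realType} {d : nat}.
Implicit Types (u v w : 'rV[R]_d) (a c : R).

Lemma dotvC u v : dotv u v = dotv v u.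
Proof. by apply: eq_bigr => j _; rewrite mulrC. Qed.

Lemma dotvDl u v w : dotv (u + v) w = dotv u w + dotv v w.
Proof. by rewrite -big_split; apply: eq_bigr => j _; rewrite mxE mulrDl. Qed.

Lemma dotvZl a u v : dotv (a *: u) v = a * dotv u v.
Proof. by rewrite mulr_sumr; apply: eq_bigr => j _; rewrite mxE mulrA. Qed.

Lemma dotvDr u v w : dotv u (v + w) = dotv u v + dotv u w.
Proof. by rewrite dotvC dotvDl !(dotvC u). Qed.

Lemma dotvZr a u v : dotv u (a *: v) = a * dotv u v.
Proof. by rewrite dotvC dotvZl dotvC. Qed.

Lemma dotvBl u v w : dotv (u - v) w = dotv u w - dotv v w.
Proof. by rewrite dotvDl -scaleN1r dotvZl mulN1r. Qed.

Lemma dotvv_ge0 u : 0 <= dotv u u.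
Proof. by apply: sumr_ge0 => j _; rewrite -expr2 sqr_ge0. Qed.

Lemma norm2_ge0 u : 0 <= norm2 u.
Proof. exact: sqrtr_ge0. Qed.

Lemma sqr_norm2 u : norm2 u ^+ 2 = dotv u u.
Proof. by rewrite sqr_sqrtr ?dotvv_ge0. Qed.

Lemma dotvv_eq0 u : dotv u u = 0 -> u = 0.
Proof.
move=> u0; apply/rowP => j; rewrite mxE; apply/eqP.
rewrite -sqrf_eq0 expr2; apply/eqP.
by apply: (psumr_eq0P _ u0) => // k _; rewrite -expr2 sqr_ge0.
Qed.

Lemma norm2Z a u : norm2 (a *: u) = `|a| * norm2 u.
Proof.
by rewrite /norm2 dotvZl dotvZr mulrA -expr2 sqrtrM ?sqr_ge0 // sqrtr_sqr.
Qed.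

Lemma norm2_0 : norm2 (0 : 'rV[R]_d) = 0.
Proof. by rewrite -(scale0r (0 : 'rV[R]_d)) norm2Z normr0 mul0r. Qed.

Lemma norm2N u : norm2 (- u) = norm2 u.
Proof. by rewrite -scaleN1r norm2Z normrN1 mul1r. Qed.

Lemma dotv_CauchySchwarz u v : `|dotv u v| <= norm2 u * norm2 v.
Proof.
rewrite -(ler_pXn2r (n := 2)) ?nnegrE ?mulr_ge0 ?norm2_ge0 //.
rewrite real_normK ?num_real // exprMn !sqr_norm2.
have [v0|vN0] := eqVneq (dotv v v) 0.
  have -> : v = 0 by exact: dotvv_eq0.
  by rewrite -(scale0r (0 : 'rV[R]_d)) !dotvZr !mul0r mulr0 expr0n.
have v_gt0 : 0 < dotv v v by rewrite lt_def vN0 dotvv_ge0.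
(* Up to the factor [dotv v v], this vector is the component of [u] orthogonal to [v]; its squared
   norm is [V * (U * V - P ^+ 2)]. *)
have := dotvv_ge0 (dotv v v *: u + (- dotv u v) *: v).
rewrite !dotvDl !dotvDr !dotvZl !dotvZr (dotvC v u).
set U := dotv u u; set V := dotv v v in v_gt0 *; set P := dotv u v => h.
by rewrite -(ler_pM2l v_gt0); lra.
Qed.

Lemma norm2D u v : norm2 (u + v) <= norm2 u + norm2 v.
Proof.
rewrite -(ler_pXn2r (n := 2)) ?nnegrE ?addr_ge0 ?norm2_ge0 //.
rewrite sqr_norm2 sqrrD !sqr_norm2 dotvDl !dotvDr (dotvC v u).
have := le_trans (ler_norm _) (dotv_CauchySchwarz u v); lra.
Qed.

Lemma norm2B u v : norm2 (u - v) <= norm2 u + norm2 v.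
Proof. by rewrite -(norm2N v) norm2D. Qed.

(** The factor [d], cruder than its square root, keeps later bounds polynomial in [d]. Positivity of
    [d] supplies a coordinate, hence [0 <= c]. *)
Lemma norm2_le_coord c u :
  (0 < d)%N -> (forall j, `|u 0 j| <= c) -> norm2 u <= d%:R * c.
Proof.
move=> d0 uc; have c0 : 0 <= c by apply: le_trans (uc (Ordinal d0)).
rewrite -(ler_pXn2r (n := 2)) ?nnegrE ?mulr_ge0 ?norm2_ge0 // sqr_norm2.
apply: (@le_trans _ _ (\sum_(j < d) c ^+ 2)).
  apply: ler_sum => j _; rewrite -expr2 -real_normK ?num_real //.
  by rewrite lerXn2r ?nnegrE.
rewrite sumr_const card_ord -[leLHS]mulr_natl exprMn ler_wpM2r ?sqr_ge0 //.
by rewrite ler_eXnr // ler1n.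
Qed.

Lemma dotv_Gamma u (x : 'rV[R]_d) : inGamma x -> `|dotv u x| <= norm2 u.
Proof.
move=> xG; apply: le_trans (dotv_CauchySchwarz _ _) _.
by rewrite ler_piMr ?norm2_ge0.
Qed.

Lemma Gamma_weight (x : 'rV[R]_d) : inGamma x -> `|dotv x x - 1| <= 1.
Proof.
move=> xG; have x0 := dotvv_ge0 x.
have : dotv x x <= 1 by rewrite -sqr_norm2 exprn_ile1 ?norm2_ge0.
by rewrite ler_norml => ?; apply/andP; split; lra.
Qed.

End Norm.

(** * Sup bounds for integrals over boxes *)

Section Integral.
Context {R : realType}.

(* No measurability is needed: the integral of a nonnegative function is a
   supremum over the simple functions below it, hence monotone. *)
Lemma ge0_le_integral_cst {dp : measure_display} {T : measurableType dp}
    (mu : {measure set T -> \bar R}) (D : set T) (F : T -> \bar R) (c : R) :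
  measurable D -> (forall x, D x -> 0 <= F x <= c%:E)%E ->
  (\int[mu]_(x in D) F x <= c%:E * mu D)%E.
Proof.
move=> mD Fc; rewrite -[leRHS](integral_cst mu mD c%:E).
have F0 x : D x -> (0 <= F x)%E by move=> /Fc /andP[].
have c0 x : D x -> (0 <= cst c%:E x)%E.
  by move=> /[dup] /F0 F0x /Fc /andP[_]; exact: le_trans.
rewrite !ge0_integralE //; apply: ereal_sup_le => _ [h /= hF <-].
exists h => //= x; apply: le_trans (hF x) _; rewrite /patch.
by case: ifPn => //; rewrite inE => /Fc /andP[].
Qed.

Lemma Rintegral_norm_le {dp : measure_display} {T : measurableType dp}
    (mu : {measure set T -> \bar R}) (D : set T) (F : T -> R) (c r : R) :
  measurable D -> mu D = r%:E -> (forall x, D x -> `|F x| <= c) ->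
  `|Rintegral mu D F| <= c * r.
Proof.
move=> mD muD Fc; rewrite /Rintegral integralE.
(* Applied to the positive and negative parts of [F]: both integrals are finite and lie between 0
   and [c * r], so their difference is real and at most [c * r] in absolute value. *)
have bnd (g : T -> \bar R) : (forall x, D x -> 0 <= g x <= c%:E)%E ->
    exists2 y, (\int[mu]_(x in D) g x)%E = y%:E & 0 <= y <= c * r.
  move=> gc; have := ge0_le_integral_cst mu mD gc; rewrite muD -EFinM.
  have : (0 <= \int[mu]_(x in D) g x)%E.
    by apply: integral_ge0 => x /gc /andP[].
  case: (\int[mu]_(x in D) g x)%E => [y| |] //=; rewrite !lee_fin => y0 yc.
  by exists y => //; rewrite y0.
have [x Dx|p -> /andP[p0 pc]] := bnd (fun x => (fun x => (F x)%:E)^\+ x)%E.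
  rewrite funepos_ge0 funeposE -EFin_max lee_fin ge_max /=.
  have := Fc x Dx; rewrite ler_norml => /andP[? ?].
  by apply/andP; split; lra.
have [x Dx|n -> /andP[n0 nc]] := bnd (fun x => (fun x => (F x)%:E)^\- x)%E.
  rewrite funeneg_ge0 funenegE -EFinN -EFin_max lee_fin ge_max /=.
  have := Fc x Dx; rewrite ler_norml => /andP[? ?].
  by apply/andP; split; lra.
by rewrite -EFinB /= ler_norml; apply/andP; split; lra.
Qed.

(** Induction on the number of variables: the bound on the inner integral is uniform in the outer
    variable, whose interval contributes its length [2 * r]. *)
Lemma box_int_norm_le (rs : seq R) (F : seq R -> R) (c : R) :
  all (fun r => 0 < r) rs ->
  (forall v, size v = size rs -> all2 (fun t r => `|t| <= r) v rs ->
     `|F v| <= c) ->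
  `|box_int rs F| <= c * \prod_(r <- rs) (2 * r).
Proof.
elim: rs F c => [|r rs IH] F c /=; first by move=> _ Fc; rewrite big_nil mulr1 Fc.
move=> /andP[r0 rs0] Fc; rewrite big_cons mulrCA [leRHS]mulrC.
apply: Rintegral_norm_le => [//||s /=].
- apply: (etrans (lebesgue_measure_itv `[- r, r])).
  rewrite /= lte_fin ifT; last lra.
  by rewrite -EFinB opprK; congr _%:E; ring.
- rewrite in_itv /= -ler_norml => sr; apply: IH => // v sv vr.
  by apply: Fc => /=; rewrite ?sv // sr.
Qed.

End Integral.

(** * Bounds for a single neuron *)

Section Network.
Context {R : realType} {d : nat}.
Implicit Types (w x : 'rV[R]_d) (a b E del : R).

(* zeta(x; a, w, b) = a * weight w b x * x on {w . x + b >= 0}. *)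
Definition weight w b x : R :=
  let s := dotv w x + b in
  2 * d%:R * s ^+ 2 + 12 * dotv w x * s + 6 * dotv w w * (dotv x x - 1).

(** On the unit ball the three summands cost [2 * d], 12 and 6 times [E ^+ 2]; [1 <= d] merges them
    into [20 * d]. *)
Lemma weight_le w b x E : (0 < d)%N -> inGamma x -> norm2 w <= E ->
  `|dotv w x + b| <= E -> `|weight w b x| <= 20 * d%:R * E ^+ 2.
Proof.
move=> d0 xG wE sE; have d1 : 1 <= d%:R :> R by rewrite ler1n.
have uE := le_trans (dotv_Gamma w xG) wE; have q1 := Gamma_weight xG.
have E0 : 0 <= E := le_trans (norm2_ge0 w) wE.
rewrite /weight -(sqr_norm2 w); move: (norm2 w) (norm2_ge0 w) wE => n n0 nE.
set s := dotv w x + b in sE *; set u := dotv w x in uE *.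
set q := dotv x x - 1 in q1 *.
have h1 : `|2 * d%:R * s ^+ 2| <= 2 * d%:R * E ^+ 2.
  by rewrite normrM normrX ger0_norm ?ler_wpM2l ?lerXn2r ?nnegrE //; lra.
have h2 : `|12 * u * s| <= 12 * E ^+ 2.
  by rewrite -mulrA normrM normrM expr2 ger0_norm // ler_wpM2l // ler_pM.
have h3 : `|6 * n ^+ 2 * q| <= 6 * E ^+ 2.
  rewrite normrM -[leRHS]mulr1 ler_pM // ger0_norm ?mulr_ge0 ?sqr_ge0 //.
  by rewrite ler_wpM2l // lerXn2r.
have h4 : E ^+ 2 <= d%:R * E ^+ 2 by rewrite ler_peMl ?sqr_ge0.
have := ler_normD (2 * d%:R * s ^+ 2 + 12 * u * s) (6 * n ^+ 2 * q).
have := ler_normD (2 * d%:R * s ^+ 2) (12 * u * s).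
lra.
Qed.

(** * A neuron moved by at most [del] from its initial weight *)

Section Perturbation.
Variables (w0 w x : 'rV[R]_d) (b E del : R).
Hypotheses (d0 : (0 < d)%N) (xG : inGamma x).
Hypotheses (w0E : norm2 w0 <= E) (s0E : `|dotv w0 x + b| <= E).
Hypothesis wdel : norm2 (w - w0) <= del.

Let E0 : 0 <= E. Proof. exact: le_trans (norm2_ge0 w0) w0E. Qed.
Let del0 : 0 <= del. Proof. exact: le_trans (norm2_ge0 _) wdel. Qed.
Let d1 : 1 <= d%:R :> R. Proof. by rewrite ler1n. Qed.

Lemma norm2_perturb : norm2 w <= E + del.
Proof.
by have := norm2D (w - w0) w0; rewrite subrK; move: wdel w0E; lra.
Qed.

Lemma dotv_perturb : `|dotv w x - dotv w0 x| <= del.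
Proof. by rewrite -dotvBl; apply: le_trans (dotv_Gamma _ xG) wdel. Qed.

Lemma preact_perturb : `|dotv w x + b| <= E + del.
Proof.
have := dotv_perturb; move: s0E; rewrite !ler_norml => /andP[? ?] /andP[? ?].
by apply/andP; split; lra.
Qed.

(** Differences of squares factor as [(y - z) * (y + z)], with factors at most [del] and
    [2 * E + del]; the coefficients again sum to at most [20 * d]. *)
Lemma weight_lip :
  `|weight w b x - weight w0 b x| <= 20 * d%:R * (del * (2 * E + del)).
Proof.
have E_ge0 := E0; have del_ge0 := del0; have wdel' := wdel.
have wM := norm2_perturb; have sM := preact_perturb.
have u0E := le_trans (dotv_Gamma w0 xG) w0E.
have uM := le_trans (dotv_Gamma w xG) wM.
have q1 := Gamma_weight xG; have du := dotv_perturb.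
have dn : `|norm2 w - norm2 w0| <= del.
  have := norm2D (w - w0) w0; have := norm2D (w0 - w) w; rewrite !subrK.
  rewrite -[norm2 (w0 - w)]norm2N opprB ler_norml => ? ?.
  by apply/andP; split; lra.
rewrite /weight -(sqr_norm2 w) -(sqr_norm2 w0).
move: (norm2 w) (norm2_ge0 w) wM dn => n n_ge0 nM dn.
move: (norm2 w0) (norm2_ge0 w0) w0E dn => n0 n0_ge0 n0E dn.
move: s0E sM; set s := dotv w x + b; set s0 := dotv w0 x + b => s0E' sM.
have ds : `|s - s0| <= del.
  by rewrite (_ : s - s0 = dotv w x - dotv w0 x) // /s /s0; ring.
set u := dotv w x in uM du *; set u0 := dotv w0 x in u0E du *.
set q := dotv x x - 1 in q1 *.
have Z0 : 0 <= del * (2 * E + del) by rewrite mulr_ge0; lra.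
have sum2 y z : `|y| <= E + del -> `|z| <= E -> `|y + z| <= 2 * E + del.
  by move=> ? ?; have := ler_normD y z; lra.
have h1 : `|2 * d%:R * (s ^+ 2 - s0 ^+ 2)| <= 2 * d%:R * (del * (2 * E + del)).
  rewrite normrM ger0_norm ?mulr_ge0 // ler_wpM2l ?mulr_ge0 //.
  by rewrite subr_sqr normrM ler_pM // sum2.
(* The product [u * s] is changed one factor at a time, at cost [(E + del) * del + del * E]. *)
have h2 : `|12 * (u * (s - s0) + (u - u0) * s0)| <= 12 * (del * (2 * E + del)).
  rewrite normrM ger0_norm // ler_wpM2l //.
  apply: le_trans (ler_normD _ _) _; rewrite !normrM.
  have := ler_pM (normr_ge0 _) (normr_ge0 _) uM ds.
  have := ler_pM (normr_ge0 _) (normr_ge0 _) du s0E'; lra.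
have h3 : `|6 * ((n ^+ 2 - n0 ^+ 2) * q)| <= 6 * (del * (2 * E + del)).
  rewrite normrM ger0_norm // ler_wpM2l // normrM -[leRHS]mulr1 ler_pM //.
  by rewrite subr_sqr normrM ler_pM // sum2 // ger0_norm.
have h4 : del * (2 * E + del) <= d%:R * (del * (2 * E + del)).
  by rewrite ler_peMl.
have := ler_normD (2 * d%:R * (s ^+ 2 - s0 ^+ 2)
  + 12 * (u * (s - s0) + (u - u0) * s0)) (6 * ((n ^+ 2 - n0 ^+ 2) * q)).
have := ler_normD (2 * d%:R * (s ^+ 2 - s0 ^+ 2))
  (12 * (u * (s - s0) + (u - u0) * s0)).
rewrite (_ : 2 * d%:R * s ^+ 2 + _ + _ - _ = 2 * d%:R * (s ^+ 2 - s0 ^+ 2)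
  + 12 * (u * (s - s0) + (u - u0) * s0) + 6 * ((n ^+ 2 - n0 ^+ 2) * q)).
  by lra.
ring.
Qed.

(* A sign change of the preactivation forces |w . x + b| <= del. *)
Lemma linearization_le :
  `|(if 0 <= dotv w x + b then (dotv w x + b) * weight w b x else 0)
    - (if 0 <= dotv w0 x + b then (dotv w x + b) * weight w0 b x else 0)|
  <= 80 * d%:R * (del * (E ^+ 2 + del ^+ 2)).
Proof.
have E_ge0 := E0; have del_ge0 := del0.
have sM := preact_perturb; have du := dotv_perturb; have PL := weight_lip.
have P0 := weight_le d0 xG w0E s0E.
have P1 := weight_le d0 xG norm2_perturb sM.
move: du; rewrite ler_norml => /andP[du1 du2].
set s := dotv w x + b in sM *.
have sign_change : `|s| <= del -> forall Q : R,
    `|Q| <= 20 * d%:R * (E + del) ^+ 2 ->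
    `|s * Q| <= 20 * d%:R * (del * (2 * (E + del) ^+ 2)).
  move=> sdel Q QM; rewrite normrM.
  have := ler_pM (normr_ge0 _) (normr_ge0 _) sdel QM => /le_trans; apply.
  have : 0 <= d%:R * (del * (E + del) ^+ 2) by rewrite !mulr_ge0 ?addr_ge0.
  lra.
have EM : 20 * d%:R * E ^+ 2 <= 20 * d%:R * (E + del) ^+ 2.
  by rewrite ler_wpM2l ?mulr_ge0 // lerXn2r ?nnegrE; lra.
(* All four sign cases meet this common bound, which implies the stated one because [(E + del) ^+ 2
   <= 2 * (E ^+ 2 + del ^+ 2)]. *)
apply: (@le_trans _ _ (20 * d%:R * (del * (2 * (E + del) ^+ 2)))); last first.
  have : 0 <= d%:R * (del * (E - del) ^+ 2) by rewrite mulr_ge0 // mulr_ge0 // sqr_ge0.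
  lra.
have [s_ge0|s_lt0] := leP 0 s; have [s0_ge0|s0_lt0] := leP 0 (dotv w0 x + b).
- rewrite -mulrBr normrM.
  have := ler_pM (normr_ge0 _) (normr_ge0 _) sM PL => /le_trans; apply.
  have : 0 <= d%:R * (del * ((E + del) * del)) by rewrite !mulr_ge0 //; lra.
  lra.
- rewrite subr0; apply: sign_change => //.
  by rewrite ger0_norm //; move: s0_lt0 => /[dup]; rewrite /s; lra.
- rewrite sub0r normrN; apply: sign_change => //; last exact: le_trans P0 EM.
  by rewrite ltr0_norm //; move: s0_ge0; rewrite /s; lra.
- by rewrite subrr normr0 !mulr_ge0 ?addr_ge0.
Qed.

End Perturbation.

(** The coefficients add up: [6 * d + 24 + 12 + 6 + 12 <= 60 * d]. The radius [M] stays free because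
    it is [2 * K] along SGD and [L * B + L * eps] in the comparison with initialization. *)
Lemma grad_psi_le {m : nat} (a0 b0 : 'I_m -> R) (W : 'I_m -> 'rV[R]_d) x i A M :
  (0 < d)%N -> inGamma x -> `|a0 i| <= A -> norm2 (W i) <= M ->
  `|dotv (W i) x + b0 i| <= M ->
  norm2 (grad_psi_i a0 b0 W x i) <= A * (60 * d%:R * M ^+ 2).
Proof.
move=> d0 xG aA wM sM; have d1 : 1 <= d%:R :> R by rewrite ler1n.
have A0 : 0 <= A := le_trans (normr_ge0 _) aA.
have M0 : 0 <= M := le_trans (norm2_ge0 _) wM.
rewrite /grad_psi_i; case: ifP => _; last first.
  by rewrite norm2_0 !mulr_ge0 ?sqr_ge0.
rewrite norm2Z ler_pM ?norm2_ge0 //.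
have uM := le_trans (dotv_Gamma _ xG) wM; have q1 := Gamma_weight xG.
apply: le_trans (norm2D _ _) _; rewrite !norm2Z.
have c1 (y : R) : `|y| * norm2 x <= `|y| by rewrite ler_piMr.
apply: (le_trans (lerD (c1 _) (lexx _))).
rewrite -(sqr_norm2 (W i)).
move: (norm2 (W i)) (norm2_ge0 (W i)) wM => n n0 nM.
set s := dotv (W i) x + b0 i in sM *; set u := dotv (W i) x in uM *.
set q := dotv x x - 1 in q1 *.
have M2 y z : `|y| <= M -> `|z| <= M -> `|y * z| <= M ^+ 2.
  by move=> ? ?; rewrite normrM expr2 ler_pM.
have h1 : `|6 * d%:R * s ^+ 2| <= 6 * d%:R * M ^+ 2.
  by rewrite normrM ger0_norm ?mulr_ge0 // ler_wpM2l ?mulr_ge0 // M2.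
have h2 : `|24 * (s * u)| <= 24 * M ^+ 2.
  by rewrite normrM ger0_norm // ler_wpM2l // M2.
have h3 : `|12 * s ^+ 2| <= 12 * M ^+ 2.
  by rewrite normrM ger0_norm // ler_wpM2l // M2.
have h4 : `|6 * (q * n ^+ 2)| <= 6 * M ^+ 2.
  rewrite normrM ger0_norm // ler_wpM2l // normrM -[leRHS]mul1r ler_pM //.
  by rewrite M2 // ger0_norm.
have h5 : `|12 * s * q| * n <= 12 * M ^+ 2.
  rewrite expr2 mulrA ler_pM // normrM -[leRHS]mulr1 ler_pM //.
  by rewrite normrM ger0_norm // ler_wpM2l.
have h6 : M ^+ 2 <= d%:R * M ^+ 2 by rewrite ler_peMl ?sqr_ge0.
have := ler_normD (6 * d%:R * s ^+ 2 + 24 * (s * u) + 12 * s ^+ 2)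
  (6 * (q * n ^+ 2)).
have := ler_normD (6 * d%:R * s ^+ 2 + 24 * (s * u)) (12 * s ^+ 2).
have := ler_normD (6 * d%:R * s ^+ 2) (24 * (s * u)).
rewrite -(mulrA 24) -(mulrA 6 q).
lra.
Qed.

(** Serves twice: for the integrand representing [f], and for the gradient of [g], which is [zeta]
    at the initial parameters. *)
Lemma norm2_zeta_le a w b x A E : (0 < d)%N -> inGamma x -> `|a| <= A ->
  norm2 w <= E -> `|dotv w x + b| <= E ->
  norm2 (zeta a w b x) <= A * (20 * d%:R * E ^+ 2).
Proof.
move=> d0 xG aA wE sE; rewrite /zeta -/(weight w b x) norm2Z.
have A0 : 0 <= A := le_trans (normr_ge0 _) aA.
have E0 : 0 <= E := le_trans (norm2_ge0 _) wE.
rewrite -[leRHS]mulr1 ler_pM ?norm2_ge0 //; case: ifP => _.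
  by rewrite normrM ler_pM // weight_le.
by rewrite normr0 !mulr_ge0 ?sqr_ge0.
Qed.

End Network.

(** * Powers of the width, the size of [f], and the SGD displacement *)

Section Class.
Context {R : realType} {d : nat}.

(** All width exponents in the theorem have this form, so its bounds become polynomial in [m],
    [mpow m (- al)] and [mpow m (- be)]. *)
Lemma mpowE (m n k l : nat) (al be p : R) : (0 < m)%N ->
  p = n%:R - k%:R * al - l%:R * be ->
  mpow m p = m%:R ^+ n * mpow m (- al) ^+ k * mpow m (- be) ^+ l.
Proof.
move=> m0 ->; have mN0 : (m%:R : R) != 0 by rewrite pnatr_eq0 -lt0n.
rewrite /mpow -!(powR_mulrn _ (powR_ge0 _ _)) -powR_mulrn // -!powRrM.
by rewrite -!powRD ?mN0 ?implybT //; congr (_ `^ _); ring.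
Qed.

Lemma mpow_gt0 (m : nat) (p : R) : (0 < m)%N -> 0 < mpow m p.
Proof. by move=> m0; rewrite powR_gt0 // ltr0n. Qed.

Lemma mpow_le1 (m : nat) (p : R) : (0 < m)%N -> 0 <= p -> mpow m (- p) <= 1.
Proof.
move=> m0 p0; rewrite /mpow -[leRHS](powRr0 (m%:R : R)); apply: ler_powR.
  by rewrite ler1n.
by rewrite oppr_le0.
Qed.

(** One scale for both quantities, valid at initialization and at every point of the parameter box:
    the norm costs [d * B], the bias another [B <= d * B]. *)
Lemma init_bound (w x : 'rV[R]_d) (b B : R) : (0 < d)%N -> inGamma x ->
  (forall j, `|w 0 j| <= B) -> `|b| <= B ->
  norm2 w <= 2 * d%:R * B /\ `|dotv w x + b| <= 2 * d%:R * B.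
Proof.
move=> d0 xG wB bB; have B0 : 0 <= B := le_trans (normr_ge0 _) bB.
have BdB : B <= d%:R * B by rewrite ler_peMl // ler1n.
have wdB := norm2_le_coord d0 wB.
split; first lra.
apply: le_trans (ler_normD _ _) _.
have := dotv_Gamma w xG; lra.
Qed.

Lemma all2_nseq_nth (n : nat) (v : seq R) (c : R) (j : nat) :
  all2 (fun t r => `|t| <= r) v (nseq n c) -> (j < n)%N -> `|nth 0 v j| <= c.
Proof.
elim: n v j => [|n IH] [|t v] [|j] //= /andP[tc vc]; rewrite ltnS => jn //.
exact: IH.
Qed.

Lemma radii_gt0 (m : nat) (al be : R) :
  (0 < m)%N -> all (fun r => 0 < r) (radii d m al be).
Proof. by move=> m0; rewrite /= !mpow_gt0 //= all_nseq mpow_gt0 // orbT. Qed.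

Lemma volLambda_gt0 (m : nat) (al be : R) : (0 < m)%N -> 0 < volLambda d m al be.
Proof.
move=> m0; rewrite /volLambda; have := @radii_gt0 m al be m0.
elim: (radii d m al be) => [|r rs IH] /=; first by rewrite big_nil.
by move=> /andP[r0 /IH rs0]; rewrite big_cons !mulr_gt0.
Qed.

Section Norm.
Variables (m : nat) (al be nf : R) (f : 'rV[R]_d -> R).
Hypotheses (d0 : (0 < d)%N) (m0 : (0 < m)%N) (fF : Fnorm_is m al be f nf).

(** The attained bound [nf] dominates a nonnegative quotient at the zero parameter. *)
Lemma Fnorm_ge0 : 0 <= nf.
Proof.
case: fF => -[alpha [_ /(_ (nseq d.+2 0))]] + _.
have vol0 := @volLambda_gt0 m al be m0.
have th0 : inLambda d m al be (nseq d.+2 0).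
  split; first by rewrite size_nseq.
  rewrite /= normr0 !ltW ?mpow_gt0 //=.
  by elim: d => //= n ->; rewrite normr0 ltW // mpow_gt0.
move=> /(_ th0); apply: le_trans.
by rewrite divr_ge0 ?norm2_ge0 // invr_ge0 ltW.
Qed.

(** The integrand is at most [nf * pdens] times the bound on [zeta], and the density cancels the
    volume of the box. The constant is [20 * d * (2 * d) ^+ 2]. *)
Lemma F_le x : inGamma x -> `|f x| <=
  80 * d%:R ^+ 3 * (mpow m (- al) * mpow m (- be) ^+ 2 * nf).
Proof.
move=> xG; case: fF => -[alpha [[_ /(_ x xG) ->] nfP]] _.
set A := mpow m (- al); set B := mpow m (- be).
have vol0 := @volLambda_gt0 m al be m0.
have A0 : 0 < A by exact: mpow_gt0.
pose c := nf * pdens d m al be * (A * (20 * d%:R * (2 * d%:R * B) ^+ 2)).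
apply: (@le_trans _ _ (c * volLambda d m al be)).
  apply: box_int_norm_le => [|th sth thr]; first exact: radii_gt0.
  have thL : inLambda d m al be th by split => //; rewrite sth /= size_nseq.
  apply: le_trans (dotv_CauchySchwarz _ _) _.
  have := nfP th thL; rewrite ler_pdivrMr ?invr_gt0 // => alphaP.
  rewrite ler_pM ?norm2_ge0 //.
  case: th sth thr {thL alphaP} => [//|a v] [sv]; rewrite [all2 _ _ _]/=.
  move=> /andP[aA vB].
  have vB' j : (j < d.+1)%N -> `|nth 0 v j| <= B by exact: all2_nseq_nth.
  have [wE sE] : norm2 (th_w d (a :: v)) <= 2 * d%:R * B /\
      `|dotv (th_w d (a :: v)) x + th_b d (a :: v)| <= 2 * d%:R * B.
    apply: init_bound => // [j|]; last exact: vB'.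
    by rewrite mxE; apply: vB'; rewrite ltnS ltnW.
  exact: norm2_zeta_le.
rewrite le_eqVlt; apply/orP; left; apply/eqP; rewrite /c /pdens.
by field; rewrite gt_eqF.
Qed.

End Norm.

(** Triangle inequality over [t] steps. The step leaving iterate [s] uses sample [xs s.+1], so
    gradient bounds are required only at iterates before [t]. *)
Lemma sgd_displacement (m : nat) (a0 b0 : 'I_m -> R) (f : 'rV[R]_d -> R)
    (eta c : R) (W0 : 'I_m -> 'rV[R]_d) (xs : nat -> 'rV[R]_d) (t : nat) k :
  0 <= eta ->
  (forall s, (s < t)%N ->
     norm2 (gradL_psi_i a0 b0 f (sgd a0 b0 f eta W0 xs s) (xs s.+1) k) <= c) ->
  norm2 (sgd a0 b0 f eta W0 xs t k - W0 k) <= eta * t%:R * c.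
Proof.
move=> eta0; elim: t => [|t IH] gc; first by rewrite subrr norm2_0 mulr0 mul0r.
rewrite /= addrAC; apply: le_trans (norm2B _ _) _.
have h1 := IH (fun s st => gc s (ltnW st)).
have h2 := gc t (ltnSn t).
rewrite norm2Z ger0_norm // -natr1 mulrDr mulr1 mulrDl.
by rewrite lerD // ler_wpM2l.
Qed.

(** No cancellation between [G] and [H] is exploited; the second summand thus survives at zero
    displacement and yields the terms of (c) free of [eta]. *)
Lemma loss_gradient_diff (G H : 'rV[R]_d) (p g y : R) :
  norm2 ((2 * (p - y)) *: G - (2 * (g - y)) *: H) <=
  2 * `|p - g| * norm2 G + 2 * (`|g| + `|y|) * (norm2 G + norm2 H).
Proof.
have -> : (2 * (p - y)) *: G - (2 * (g - y)) *: H =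
    (2 * (p - g)) *: G + (2 * (g - y)) *: (G - H).
  rewrite scalerBr addrA -scalerDl; congr (_ *: _ - _); ring.
apply: le_trans (norm2D _ _) _; rewrite !norm2Z !normrM (ger0_norm (x := 2)) //.
rewrite lerD // -!mulrA ler_wpM2l // ler_pM ?norm2_ge0 ?norm2B //.
by have := ler_normD g (- y); rewrite normrN.
Qed.

End Class.

(** Expanding the left side gives the listed monomials and one more,
    [n ^+ 2 * A ^+ 2 * B ^+ 3 * eps ^+ 2], which has to be absorbed. *)
Lemma loss_gradient_poly {R : realType} (n A B L eps F : R) :
  0 <= n -> 0 <= A -> 0 <= B -> 1 <= L -> 0 <= eps -> 0 <= F ->
  n * (2 * (n * (A * (L ^+ 4 * (B ^+ 2 * eps + eps ^+ 3))))
         * (2 * A * L ^+ 3 * (B ^+ 2 + eps ^+ 2))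
       + 2 * (n * (A * L ^+ 4 * (B + eps) * B ^+ 2) + L * (A * B ^+ 2 * F))
         * (3 * A * L ^+ 3 * (B ^+ 2 + eps ^+ 2)))
  <= 20 * L ^+ 7 * (n ^+ 2 * A ^+ 2 * eps ^+ 5
     + n ^+ 2 * A ^+ 2 * B ^+ 2 * eps ^+ 3
     + n * A ^+ 2 * B ^+ 2 * F * eps ^+ 2
     + n ^+ 2 * A ^+ 2 * B ^+ 4 * eps
     + n ^+ 2 * A ^+ 2 * B ^+ 5 + n * A ^+ 2 * B ^+ 4 * F).
Proof.
move=> n0 A0 B0 L1 e0 F0; have L0 : 0 <= L by lra.
have L47 : L ^+ 4 <= L ^+ 7 by rewrite ler_weXn2l.
(* Encodes [B * eps ^+ 2 <= B ^+ 3 + eps ^+ 3]. The largest resulting coefficient, at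
   [B ^+ 2 * eps ^+ 3], is 8 + 6 + 6 = 20. *)
have h1 : 0 <= L ^+ 7 * (n ^+ 2 * A ^+ 2 * B ^+ 2 * ((B - eps) ^+ 2 * (B + eps))).
  by rewrite !(sqr_ge0, exprn_ge0, mulr_ge0, addr_ge0).
have h2 : 0 <= (L ^+ 7 - L ^+ 4) * (n * A ^+ 2 * B ^+ 2 * F * (B ^+ 2 + eps ^+ 2)).
  by rewrite mulr_ge0 ?subr_ge0 // !(mulr_ge0, exprn_ge0, addr_ge0).
have mono q : 0 <= q -> 0 <= L ^+ 7 * q by move=> ?; rewrite mulr_ge0 ?exprn_ge0.
have h3 := mono (n ^+ 2 * A ^+ 2 * eps ^+ 5) ltac:(by rewrite !(mulr_ge0, exprn_ge0)).
have h4 := mono (n ^+ 2 * A ^+ 2 * B ^+ 4 * eps) ltac:(by rewrite !(mulr_ge0, exprn_ge0)).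
have h5 := mono (n ^+ 2 * A ^+ 2 * B ^+ 5) ltac:(by rewrite !(mulr_ge0, exprn_ge0)).
have h6 := mono (n * A ^+ 2 * B ^+ 4 * F) ltac:(by rewrite !(mulr_ge0, exprn_ge0)).
have h7 := mono (n * A ^+ 2 * B ^+ 2 * F * eps ^+ 2)
  ltac:(by rewrite !(mulr_ge0, exprn_ge0)).
have h8 := mono (n ^+ 2 * A ^+ 2 * B ^+ 2 * eps ^+ 3)
  ltac:(by rewrite !(mulr_ge0, exprn_ge0)).
lra.
Qed.

Lemma sum_ord_le {R : realType} (m : nat) (G : 'I_m -> R) (c : R) :
  (forall k, G k <= c) -> \sum_(k < m) G k <= m%:R * c.
Proof.
move=> Gc; apply: le_trans (ler_sum _ (fun k _ => Gc k)) _.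
by rewrite sumr_const card_ord mulr_natl.
Qed.

(** * Sums over the neurons at the scales [A], [B] and [eps] *)

Section Bounds.
Variables (R : realType) (d m : nat) (a0 b0 : 'I_m -> R).
Variables (W0 W : 'I_m -> 'rV[R]_d) (x : 'rV[R]_d) (A B L eps : R).
Hypotheses (d0 : (0 < d)%N) (xG : inGamma x).
Hypotheses (A0 : 0 <= A) (B0 : 0 <= B) (eps0 : 0 <= eps).
Hypotheses (L1 : 1 <= L) (DL : 80 * d%:R <= L).
Hypothesis aA : forall k, `|a0 k| <= A.
Hypothesis w0E : forall k, norm2 (W0 k) <= L * B.
Hypothesis s0E : forall k, `|dotv (W0 k) x + b0 k| <= L * B.
Hypothesis disp : forall k, norm2 (W k - W0 k) <= L * eps.

Let L0 : 0 <= L. Proof. exact: le_trans L1. Qed.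

(** With [E = L * B] and [del = L * eps], three factors [L] come from the cubic bound on each
    neuron; the fourth absorbs [80 * d]. *)
Lemma psi_gpseudo_le : `|psi a0 b0 W x - gpseudo a0 b0 W0 W x|
  <= m%:R * (A * (L ^+ 4 * (B ^+ 2 * eps + eps ^+ 3))).
Proof.
rewrite /psi /gpseudo -sumrB; apply: le_trans (ler_norm_sum _ _ _) _.
apply: sum_ord_le => k; rewrite (_ : (if _ then _ else _) - _ = a0 k *
  ((if 0 <= dotv (W k) x + b0 k
    then (dotv (W k) x + b0 k) * weight (W k) (b0 k) x else 0)
   - (if 0 <= dotv (W0 k) x + b0 k
      then (dotv (W k) x + b0 k) * weight (W0 k) (b0 k) x else 0))).
  rewrite normrM ler_pM //.
  apply: le_trans (linearization_le d0 xG (w0E k) (s0E k) (disp k)) _.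
  have h : 0 <= L ^+ 3 * (B ^+ 2 * eps + eps ^+ 3).
    by rewrite !(exprn_ge0, mulr_ge0, addr_ge0).
  have := ler_wpM2r h DL; lra.
by rewrite /weight; case: ifP => _; case: ifP => _; ring.
Qed.

Lemma gpseudo_le : `|gpseudo a0 b0 W0 W x|
  <= m%:R * (A * L ^+ 4 * (B + eps) * B ^+ 2).
Proof.
apply: le_trans (ler_norm_sum _ _ _) _; apply: sum_ord_le => k /=.
rewrite -/(weight (W0 k) (b0 k) x); case: ifP => _; last first.
  by rewrite normr0 !(exprn_ge0, mulr_ge0, addr_ge0).
have h : 0 <= A * (L * (B + eps) * (L * B) ^+ 2).
  by rewrite !(exprn_ge0, mulr_ge0, addr_ge0).
have := preact_perturb xG (s0E k) (disp k).
have := weight_le d0 xG (w0E k) (s0E k).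
rewrite !normrM => wL sL.
have h1 := ler_pM (normr_ge0 _) (normr_ge0 _) (aA k) sL.
have := ler_pM (mulr_ge0 (normr_ge0 _) (normr_ge0 _)) (normr_ge0 _) h1 wL.
move=> /le_trans; apply.
have DL' : 20 * d%:R <= L by move: DL (ler0n R d); lra.
have := ler_wpM2r h DL'; lra.
Qed.

Lemma grad_psi_init_le k :
  norm2 (grad_psi_i a0 b0 W x k) <= 2 * A * L ^+ 3 * (B ^+ 2 + eps ^+ 2).
Proof.
apply: le_trans (grad_psi_le d0 xG (aA k) (norm2_perturb (w0E k) (disp k))
  (preact_perturb xG (s0E k) (disp k))) _.
have h : 0 <= A * (L * B + L * eps) ^+ 2 by rewrite mulr_ge0 ?sqr_ge0.
(* This square bounds [(B + eps) ^+ 2] by [2 * (B ^+ 2 + eps ^+ 2)], whence the factor 2 in the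
   conclusion. *)
have h' : 0 <= A * L * (L * B - L * eps) ^+ 2.
  by rewrite mulr_ge0 ?sqr_ge0 // mulr_ge0.
have DL' : 60 * d%:R <= L by move: DL (ler0n R d); lra.
have := ler_wpM2r h DL'; lra.
Qed.

Lemma grad_g_le k : norm2 (grad_g_i a0 b0 W0 x k) <= A * L ^+ 3 * B ^+ 2.
Proof.
rewrite (_ : grad_g_i a0 b0 W0 x k = zeta (a0 k) (W0 k) (b0 k) x); last first.
  by rewrite /grad_g_i /zeta; case: ifP; rewrite ?scale0r.
apply: le_trans (norm2_zeta_le d0 xG (aA k) (w0E k) (s0E k)) _.
have h : 0 <= A * (L * B) ^+ 2 by rewrite mulr_ge0 ?sqr_ge0.
have DL' : 20 * d%:R <= L by move: DL (ler0n R d); lra.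
have := ler_wpM2r h DL'; lra.
Qed.

Lemma gradL_diff_le (f : 'rV[R]_d -> R) (F : R) :
  0 <= F -> `|f x| <= L * (A * B ^+ 2 * F) ->
  norm21 (fun k => gradL_psi_i a0 b0 f W x k - gradL_g_i a0 b0 f W0 W x k)
  <= 20 * L ^+ 7 * (m%:R ^+ 2 * A ^+ 2 * eps ^+ 5
     + m%:R ^+ 2 * A ^+ 2 * B ^+ 2 * eps ^+ 3
     + m%:R * A ^+ 2 * B ^+ 2 * F * eps ^+ 2
     + m%:R ^+ 2 * A ^+ 2 * B ^+ 4 * eps
     + m%:R ^+ 2 * A ^+ 2 * B ^+ 5 + m%:R * A ^+ 2 * B ^+ 4 * F).
Proof.
move=> F0 fx; apply: le_trans (sum_ord_le (c :=
    2 * (m%:R * (A * (L ^+ 4 * (B ^+ 2 * eps + eps ^+ 3))))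
      * (2 * A * L ^+ 3 * (B ^+ 2 + eps ^+ 2))
    + 2 * (m%:R * (A * L ^+ 4 * (B + eps) * B ^+ 2) + L * (A * B ^+ 2 * F))
      * (3 * A * L ^+ 3 * (B ^+ 2 + eps ^+ 2))) _) _; last first.
  exact: loss_gradient_poly.
move=> k; rewrite /gradL_psi_i /gradL_g_i.
apply: le_trans (loss_gradient_diff _ _ _ _ _) _.
have pg := psi_gpseudo_le; have gB := gpseudo_le.
have G1 := grad_psi_init_le k; have G2 := grad_g_le k.
have GH : norm2 (grad_psi_i a0 b0 W x k) + norm2 (grad_g_i a0 b0 W0 x k)
    <= 3 * A * L ^+ 3 * (B ^+ 2 + eps ^+ 2).
  have : 0 <= A * L ^+ 3 * eps ^+ 2 by rewrite !(exprn_ge0, mulr_ge0).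
  lra.
rewrite lerD // ler_pM ?norm2_ge0 ?addr_ge0 ?norm2_ge0 ?mulr_ge0 ?addr_ge0 //.
- by rewrite ler_wpM2l.
- by rewrite ler_wpM2l // lerD.
Qed.

End Bounds.

(** * The uniform constant and the three estimates *)

Unset Implicit Arguments.

Theorem theorem3p3 (R : realType) (d : nat) (K : R) :
  (0 < d)%N -> 1 <= K ->
  exists C : R, 0 < C /\
  forall (al be eta : R) (m T N : nat)
         (a0 b0 : 'I_m -> R) (W0 : 'I_m -> 'rV[R]_d)
         (X : 'I_N -> 'rV[R]_d) (pick : nat -> 'I_N)
         (f : 'rV[R]_d -> R) (nf : R),
  0 <= al -> 0 <= be -> (0 < m)%N -> 0 < eta ->
  (* a realization of the random initialization *)
  (forall i, `|a0 i| <= mpow m (- al)) ->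
  (forall i j, `|W0 i 0 j| <= mpow m (- be)) ->
  (forall i, `|b0 i| <= mpow m (- be)) ->
  (* training set in Gamma *)
  (forall k, inGamma (X k)) ->
  (* f in the class F, with ||f||_F = nf *)
  Fnorm_is m al be f nf ->
  let Wt := sgd a0 b0 f eta W0 (fun t => X (pick t)) in
  (* no-explosion assumption *)
  (forall t : nat, (t <= T)%N ->
     (forall i, norm2 (Wt t i) <= K) /\
     (forall x, inGamma x -> `|psi a0 b0 (Wt t) x| <= K)) ->
  let rho := mpow m (- al - 2 * be) * nf + 1 in
  forall (x : 'rV[R]_d) (t : nat) (i : 'I_m),
    inGamma x -> (1 <= t <= T)%N ->
    let e := eta * t%:R in
    (* (a) *)
    norm2 (Wt t i - W0 i) <= C * e * mpow m (- al) * rho /\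
    (* (b) *)
    `|psi a0 b0 (Wt t) x - gpseudo a0 b0 W0 (Wt t) x|
      <= C * (e ^+ 3 * mpow m (1 - 4 * al) * rho ^+ 3
              + e * mpow m (1 - 2 * al - 2 * be) * rho) /\
    (* (c) *)
    norm21 (fun k => gradL_psi_i a0 b0 f (Wt t) x k
                     - gradL_g_i a0 b0 f W0 (Wt t) x k)
      <= C * (e ^+ 5 * mpow m (2 - 7 * al) * rho ^+ 5
              + e ^+ 3 * mpow m (2 - 5 * al - 2 * be) * rho ^+ 3
              + e ^+ 2 * mpow m (2 - 4 * al - 3 * be) * rho ^+ 2
              + e ^+ 2 * mpow m (1 - 4 * al - 2 * be) * nf * rho ^+ 2
              + e * mpow m (2 - 3 * al - 4 * be) * rho
              + mpow m (2 - 2 * al - 5 * be)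
              + mpow m (1 - 2 * al - 4 * be) * nf).
Proof.
move=> d0 K1; have D1 : 1 <= d%:R :> R by rewrite ler1n.
(* 160 d^3 K rho bounds the factor 2 (psi - f) of the loss gradient, and
   240 d K^2 A the gradient of psi. *)
pose L : R := 160 * 240 * (d%:R ^+ 4 * K ^+ 3).
have K3 : 1 <= K ^+ 3 by rewrite exprn_ege1.
have DD3 : d%:R ^+ 3 <= d%:R ^+ 4 :> R by rewrite ler_weXn2l.
have DD1 : d%:R <= d%:R ^+ 4 :> R by rewrite ler_eXnr.
have DK : d%:R ^+ 4 <= d%:R ^+ 4 * K ^+ 3 by rewrite ler_peMr ?exprn_ge0.
have D4L : 80 * d%:R ^+ 4 <= L by rewrite /L; lra.
have L1 : 1 <= L by lra.
have L0 : 0 <= L by lra.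
(* The constant [20 * L ^+ 7] is dictated by (c); it also dominates [L] in (a) and [L ^+ 4] in
   (b). *)
have LC (k : nat) : (k <= 7)%N -> L ^+ k <= 20 * L ^+ 7.
  move=> k7; have := ler_weXn2l L1 k7; have : 0 <= L ^+ 7 by rewrite exprn_ge0.
  lra.
exists (20 * L ^+ 7); split; first by rewrite mulr_gt0 // exprn_gt0 //; lra.
move=> al be eta m T N a0 b0 W0 X pick f nf al0 be0 m0 eta0 aA w0B bB XG fF.
move=> Wt noexp rho x t i xG /andP[_ tT] e.
have F0 := Fnorm_ge0 m0 fF.
have B1 : mpow m (- be) <= 1 by exact: mpow_le1.
have A0 : 0 <= mpow m (- al) by rewrite ltW // mpow_gt0.
have B0 : 0 <= mpow m (- be) by rewrite ltW // mpow_gt0.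
have rhoE : rho = mpow m (- al) * mpow m (- be) ^+ 2 * nf + 1.
  rewrite /rho (@mpowE _ m 0 1 2 al be) //; ring.
have fle := F_le d0 m0 fF.
have e0 : 0 <= e by rewrite mulr_ge0 // ltW.
rewrite (@mpowE _ m 1 4 0 al be (1 - 4 * al)) //; last by ring.
rewrite (@mpowE _ m 1 2 2 al be (1 - 2 * al - 2 * be)) //.
rewrite (@mpowE _ m 2 7 0 al be (2 - 7 * al)) //; last by ring.
rewrite (@mpowE _ m 2 5 2 al be (2 - 5 * al - 2 * be)) //.
rewrite (@mpowE _ m 2 4 3 al be (2 - 4 * al - 3 * be)) //.
rewrite (@mpowE _ m 1 4 2 al be (1 - 4 * al - 2 * be)) //.
rewrite (@mpowE _ m 2 3 4 al be (2 - 3 * al - 4 * be)) //.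
rewrite (@mpowE _ m 2 2 5 al be (2 - 2 * al - 5 * be)) //.
rewrite (@mpowE _ m 1 2 4 al be (1 - 2 * al - 4 * be)) //.
clearbody rho; move: (mpow m (- al)) (mpow m (- be)) A0 B0 B1 aA w0B bB rhoE fle.
move=> A B A0 B0 B1 aA w0B bB rhoE fle.
have ABF0 : 0 <= A * B ^+ 2 * nf by rewrite !mulr_ge0 ?exprn_ge0.
have rho1 : 1 <= rho by rewrite rhoE; lra.
have rho0 : 0 <= rho by lra.
pose eps := e * A * rho.
have eps0 : 0 <= eps by rewrite mulr_ge0 // mulr_ge0.
(* This is (a) for every neuron with constant [L]; it also feeds (b) and (c). *)
have disp k : norm2 (Wt t k - W0 k) <= L * eps.
  rewrite (_ : L * eps = e * (L * A * rho)); last by rewrite /eps; ring.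
  apply: sgd_displacement => [|s st]; first exact: ltW.
  have [wK psiK] := noexp s (ltnW (leq_trans st tT)).
  have yG := XG (pick s.+1).
  rewrite -/(Wt s) /gradL_psi_i norm2Z.
  (* A common radius for weight and preactivation: the bias is at most [B <= 1 <= K], where [B <= 1]
     comes from [0 <= be]. *)
  have M2 : norm2 (Wt s k) <= 2 * K by have := wK k; lra.
  have s2 : `|dotv (Wt s k) (X (pick s.+1)) + b0 k| <= 2 * K.
    apply: le_trans (ler_normD _ _) _.
    by have := dotv_Gamma (Wt s k) yG; have := wK k; have := bB k; lra.
  have gK := grad_psi_le d0 yG (aA k) M2 s2.
  (* Here [psi] is at most [K] and [f] at most [80 * d ^+ 3 * (rho - 1)]; [1 <= K] and [1 <= d] put
     both under one product. *)
  have lossK : `|2 * (psi a0 b0 (Wt s) (X (pick s.+1)) - f (X (pick s.+1)))|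
      <= 2 * (80 * d%:R ^+ 3 * K * rho).
    rewrite normrM ger0_norm // ler_wpM2l //.
    apply: le_trans (ler_normB _ _) _; rewrite rhoE.
    have := psiK _ yG; have := fle _ yG.
    have : K <= d%:R ^+ 3 * K by rewrite ler_peMl ?exprn_ege1 //; lra.
    have : d%:R ^+ 3 * (A * B ^+ 2 * nf) <= d%:R ^+ 3 * (K * (A * B ^+ 2 * nf)).
      by rewrite ler_wpM2l ?exprn_ge0 // ler_peMl.
    lra.
  apply: le_trans (ler_pM (normr_ge0 _) (norm2_ge0 _) lossK gK) _.
  rewrite le_eqVlt; apply/orP; left; apply/eqP; rewrite /L; ring.
have epsE : eps = e * A * rho by [].
clearbody L eps e.
have E1 : 2 * d%:R * B <= L * B by rewrite ler_wpM2r //; lra.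
have w0E k : norm2 (W0 k) <= L * B.
  exact: le_trans (init_bound d0 xG (w0B k) (bB k)).1 E1.
have s0E k : `|dotv (W0 k) x + b0 k| <= L * B.
  exact: le_trans (init_bound d0 xG (w0B k) (bB k)).2 E1.
have DL : 80 * d%:R <= L by lra.
split; last split.
- rewrite (_ : _ * e * A * rho = 20 * L ^+ 7 * eps); last by rewrite epsE; ring.
  by apply: le_trans (disp i) _; rewrite ler_wpM2r // (LC 1).
- apply: le_trans (psi_gpseudo_le d0 xG B0 eps0 L1 DL aA w0E s0E disp) _.
  have h : 0 <= m%:R * A * (B ^+ 2 * eps + eps ^+ 3).
    by rewrite mulr_ge0 ?addr_ge0 ?mulr_ge0 ?exprn_ge0.
  have := ler_wpM2r h (LC 4 isT).
  rewrite epsE; clear; lra.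
- have fL : `|f x| <= L * (A * B ^+ 2 * nf).
    by apply: le_trans (fle x xG) _; rewrite ler_wpM2r //; lra.
  apply: le_trans (gradL_diff_le d0 xG A0 B0 eps0 L1 DL aA w0E s0E disp F0 fL) _.
  rewrite ler_wpM2l ?mulr_ge0 ?exprn_ge0 //.
  (* This is the [m^(2 - 4 al - 3 be)] term of (c); the other six match the polynomial bound once
     [eps] is expanded. *)
  have : 0 <= e ^+ 2 * (m%:R ^+ 2 * A ^+ 4 * B ^+ 3) * rho ^+ 2.
    by rewrite mulr_ge0 ?mulr_ge0 ?exprn_ge0.
  rewrite epsE; clear; lra.
Qed.
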